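(* Let $\overleftarrow{\mathcal{X}} = (X_i, f_i, f_{ij})$, $i\leqslant j$ in $J$, be a projective system of locally measurable topological spaces and $(X, (\mathcal{V}_x)_{x\in X}, \mathcal{F}, \tau)$ its projective limit. Let $(\mu_n)_{n\geqslant 1}$ be a sequence of probability measures on $\mathcal{F}$ and $(v_n)_{n\geqslant1}$ a sequence of strictly positive reals. For $i\in J$ let $\underline{s}_i,\overline{s}_i$ be the functions on $X_i$ associated with $(\mu_n\circ f_i^{-1},v_n)_{n\geqslant1}$, and let $\underline{s},\overline{s}$ be those on $X$ associated with $(\mu_n,v_n)_{n\geqslant1}$. (a) If, for every $i\in J$, $(\mu_n\circ f_i^{-1},v_n)_{n\geqslant1}$ satisfies $(\mathrm{SAC}_\flat)$, then $(\mu_n,v_n)_{n\geqslant1}$ satisfies $(\mathrm{SAC}_\flat)$. (b) For all $(i,j)\in J^2$ with $i\leqslant j$, $\underline{s}_i\circ f_i\geqslant\underline{s}_j\circ f_j$ and $\overline{s}_i\circ f_i\geqslant\overline{s}_j\circ f_j$. Moreover $\underline{s}=\inf_{i\in J}(\underline{s}_i\circ f_i)$ and $\overline{s}=\inf_{i\in J}(\overline{s}_i\circ f_i)$. In particular, if $\underline{s}_i=\overline{s}_i$ for every $i\in J$, then $\underline{s}=\overline{s}$. (c) Let $D\subset X$ be such that every $\mu_n$, $n\geqslant1$, is carried by $D$. If, for every $i\in J$, the compact subsets of $X_i$ are measurable and $(\mu_n\circ f_i^{-1},v_n)_{n\geqslant1}$ satisfies a weak large deviations principle, then $(\mu_n,v_n)_{n\geqslant1}$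 satisfies $(\mathrm{BS}_{\flat,D})$, i.e. for every $K\in\mathcal{F}$ such that $K\cap D$ is relatively compact in $X$, $$\limsup_{n\to\infty}\frac{1}{v_n}\log\mu_n(K)\leqslant\sup_{\overline{K}}\underline{s}.$$
   Context: All topologies are assumed Hausdorff (including that of the projective limit); $\log0=-\infty$, $\sup\emptyset=-\infty$; $\overline K$ denotes the closure of $K$. Locally measurable topological space: $(Z,(\mathcal{V}_x)_{x\in Z},\mathcal{G},\sigma)$ where $Z$ is a set, $\mathcal{G}$ a $\sigma$-algebra and $\sigma$ a topology on $Z$, and for each $x\in Z$, $\mathcal{V}_x$ is a fundamental system of neighbourhoods of $x$ consisting of measurable sets. Let $(\nu_n)_{n\geqslant1}$ be probability measures on such a $\mathcal{G}$ and $(v_n)$ strictly positive reals. For $x\in Z$: $\underline{s}(x)=\inf\liminf_{n\to\infty}\frac1{v_n}\log\nu_n(A)$ and $\overline{s}(x)=\inf\limsup_{n\to\infty}\frac1{v_n}\log\nu_n(A)$, infima over $A\in\mathcal{G}$ whose interior contains $x$. The sequence satisfies a weak large deviations principle if $\limsup_n\frac1{v_n}\log\nu_n(K)\leqslant\sup_{\overline K}\underline{s}$ for every relatively compact $K\in\mathcal{G}$. It satisfies $(\mathrm{SAC}_\flat)$ if for every $x\in Z$ and every $B\in\mathcal{V}_x$ there is $A\in\mathcal{V}_x$ with $\limsup_n\frac1{v_n}\log\nu_n(A)\leqslant\liminf_n\frac1{v_n}\log\nu_n(B)$. A probability $\nu$ on $\mathcal{G}$ is carried by $D\subset Z$ if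 for all $A,B\in\mathcal{G}$, $A\cap D=B\cap D$ implies $\nu(A)=\nu(B)$ ($D$ need not be measurable). Projective system and limit. Let $X$ be a set with a $\sigma$-algebra $\mathcal{F}$. A projective system of locally measurable topological spaces is a family $(X_i,f_i,f_{ij})_{i\leqslant j}$ indexed by a preordered upward directed set $(J,\leqslant)$ such that: for each $i\in J$, $(X_i,(\mathcal{V}_{x,i})_{x\in X_i},\mathcal{F}_i,\tau_i)$ is a locally measurable topological space and $f_i:X\to X_i$ is measurable; for $i\leqslant j$, $f_{ij}:X_j\to X_i$ is measurable and, for all $x\in X_j$ and $V\in\mathcal{V}_{f_{ij}(x),i}$, $f_{ij}^{-1}(V)\in\mathcal{V}_{x,j}$ (so $f_{ij}$ is continuous); and for $i\leqslant j\leqslant k$, $f_{ii}=\mathrm{id}_{X_i}$, $f_i=f_{ij}\circ f_j$, $f_{ik}=f_{ij}\circ f_{jk}$. Its projective limit is $X$ equipped with $\mathcal{F}$, the initial topology $\tau$ for $(f_i)_{i\in J}$, and $\mathcal{V}_x=\{f_i^{-1}(V_i): i\in J,\ V_i\in\mathcal{V}_{f_i(x),i}\}$; this is a locally measurable topological space. (It need not be the full set-theoretic projective limit.) *)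

(* Defs.v *)
From HB Require Import structures.
From mathcomp Require Import all_boot all_order all_algebra.
From mathcomp Require Import all_classical all_reals all_analysis.

Set Implicit Arguments.
Unset Strict Implicit.
Unset Printing Implicit Defensive.
Import Order.TTheory GRing.Theory Num.Theory.
Local Open Scope classical_set_scope.
Local Open Scope ring_scope.

(* Locally measurable topological spaces.  The sigma-algebra and the topology
   are only related through the local bases [nbase x] (written V_x on paper);
   in particular open sets need not be measurable.  Separation is not part of
   the structure. *)
HB.mixin Record isLocallyMeasurable (d : measure_display) T
    of Measurable d T & Topological T := {
  nbase : T -> set (set T);
  nbase_measurable : forall x V, nbase x V -> measurable V;
  nbhs_nbase : forall x, nbhs x = filter_from (nbase x) id
}.

#[short(type="locMeasType")]
HB.structure Definition LocallyMeasurable (d : measure_display) :=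
  {T of Measurable d T & Topological T & isLocallyMeasurable d T}.

Section large_deviations.
Context {R : realType} {d : measure_display} {T : locMeasType d}.
(* Sequences indexed by n >= 1 on paper are indexed by nat here: the term of
   index n stands for the paper's term of index n+1. *)
Implicit Types (nu : nat -> probability T R) (v : nat -> R).
Local Open Scope ereal_scope.

(* log 0 = -oo for [lne], whereas [ln 0 = 0]. *)
Definition log_rate nu v (A : set T) : nat -> \bar R :=
  fun n => (v n)^-1%:E * lne (nu n A).

Definition lower_rate nu v (A : set T) : \bar R := limn_einf (log_rate nu v A).

Definition upper_rate nu v (A : set T) : \bar R := limn_esup (log_rate nu v A).

Definition s_lower nu v (x : T) : \bar R :=
  ereal_inf [set lower_rate nu v A | A in [set A | measurable A /\ interior A x]].

Definition s_upper nu v (x : T) : \bar R :=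
  ereal_inf [set upper_rate nu v A | A in [set A | measurable A /\ interior A x]].

Definition weak_LDP nu v : Prop :=
  forall K : set T, measurable K -> precompact K ->
    upper_rate nu v K <= ereal_sup [set s_lower nu v x | x in closure K].

Definition SAC_flat nu v : Prop :=
  forall (x : T) (B : set T), nbase x B ->
    exists2 A : set T, nbase x A & upper_rate nu v A <= lower_rate nu v B.

Definition BS_flat (D : set T) nu v : Prop :=
  forall K : set T, measurable K -> precompact (K `&` D) ->
    upper_rate nu v K <= ereal_sup [set s_lower nu v x | x in closure K].

(* D is not assumed to be measurable. *)
Definition carried_by (P : probability T R) (D : set T) : Prop :=
  forall A B : set T, measurable A -> measurable B ->
    A `&` D = B `&` D -> P A = P B.

End large_deviations.

Definition upward_directed (disp : Order.disp_t) (J : preorderType disp) : Prop :=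
  [set: J] !=set0 /\ forall i j : J, exists k : J, (i <= k)%O /\ (j <= k)%O.

Record projSystem (disp : Order.disp_t) (J : preorderType disp)
    (d : measure_display) (X : measurableType d)
    (dJ : J -> measure_display) := ProjSystem {
  index_directed : upward_directed J;
  obj : forall i : J, locMeasType (dJ i);
  prj : forall i : J, {mfun X >-> obj i};
  trans : forall i j : J, (i <= j)%O -> {mfun obj j >-> obj i};
  trans_nbase : forall (i j : J) (ij : (i <= j)%O) (x : obj j) (V : set (obj i)),
    nbase (trans ij x) V -> nbase x (trans ij @^-1` V);
  trans_refl : forall (i : J) (ii : (i <= i)%O), trans ii =1 id;
  prj_trans : forall (i j : J) (ij : (i <= j)%O), prj i =1 trans ij \o prj j;
  trans_trans : forall (i j k : J) (ij : (i <= j)%O) (jk : (j <= k)%O)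
    (ik : (i <= k)%O), trans ik =1 trans ij \o trans jk
}.

(* The projective limit: the set X itself (not the set of compatible families)
   with its sigma-algebra, the initial topology of the maps [prj S i], and the
   local bases made of the preimages of those of the spaces [obj S i]. *)
Definition projlim (disp : Order.disp_t) (J : preorderType disp)
    (d : measure_display) (X : measurableType d) (dJ : J -> measure_display)
    (S : projSystem X dJ) : Type := X.

Section projlim_structure.
Context {disp : Order.disp_t} {J : preorderType disp} {d : measure_display}
  {X : measurableType d} {dJ : J -> measure_display} (S : projSystem X dJ).
Local Notation L := (projlim S).

HB.instance Definition _ := Measurable.copy L X.

HB.instance Definition _ := Topological.copy L
  (sup_topology (fun i : J => Topological.class (initial_topology (prj S i)))).

Definition projlim_map (i : J) : L -> obj S i := prj S i.

Let projlim_map_measurable i : measurable_fun setT (projlim_map i).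
Proof. exact: (@measurable_funPT _ _ _ _ (prj S i)). Qed.

HB.instance Definition _ i :=
  isMeasurableFun.Build _ _ L (obj S i) (projlim_map i)
    (@projlim_map_measurable i).

Definition projlim_nbase (x : L) : set (set L) :=
  [set V | exists (i : J) (W : set (obj S i)),
     nbase (projlim_map i x) W /\ V = projlim_map i @^-1` W].

Let projlim_nbase_measurable x V : projlim_nbase x V -> measurable V.
Proof.
move=> [i [W [xW ->]]]; rewrite -[_ @^-1` _]setTI.
by apply: projlim_map_measurable => //; exact: nbase_measurable xW.
Qed.

Lemma projlim_map_continuous i : continuous (projlim_map i).
Proof.
move=> x; have /cvg_sup/(_ i) h : nbhs x --> (x : L) by exact: cvg_id.
apply: cvg_trans (@initial_continuous X (obj S i) (prj S i) x).
by move=> A; apply: h.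
Qed.

Let projlim_nbhs_nbase x : nbhs x = filter_from (projlim_nbase x) id.
Proof.
have nbW (i : J) (y : obj S i) W : nbase y W -> nbhs y W.
  by move=> yW; rewrite nbhs_nbase; exists W.
have [[i0 _] dirJ] := index_directed S.
have FF : Filter (filter_from (projlim_nbase x) id).
  apply: filter_from_filter.
    have : nbhs (projlim_map i0 x) setT by exact: filterT.
    by rewrite nbhs_nbase => -[W xW _]; exists (projlim_map i0 @^-1` W), i0, W.
  move=> _ _ [i [V [xV ->]]] [j [W [xW ->]]].
  have [k [ik jk]] := dirJ i j.
  have xVk : nbase (projlim_map k x) (trans S ik @^-1` V).
    by apply: trans_nbase; have := prj_trans S ik x; rewrite /projlim_map => /= <-.
  have xWk : nbase (projlim_map k x) (trans S jk @^-1` W).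
    by apply: trans_nbase; have := prj_trans S jk x; rewrite /projlim_map => /= <-.
  have : nbhs (projlim_map k x) (trans S ik @^-1` V `&` trans S jk @^-1` W).
    by apply: filterI; exact: nbW.
  rewrite nbhs_nbase => -[U xU UVW].
  exists (projlim_map k @^-1` U); first by exists k, U.
  move=> y /UVW [/= Vy Wy]; split => /=.
    by rewrite /projlim_map (prj_trans S ik).
  by rewrite /projlim_map (prj_trans S jk).
apply/seteqP; split; last first.
  move=> A [_ [i [W [xW ->]]] WA]; apply: filterS WA _.
  exact/projlim_map_continuous/nbW.
suff : filter_from (projlim_nbase x) id --> (x : L) by [].
apply/cvg_sup => i A /=.
rewrite (@nbhsE (initial_topology (prj S i))) => -[_ [[B oB <-] Bx] BA].
have : nbhs (projlim_map i x) B by exact: open_nbhs_nbhs.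
rewrite nbhs_nbase => -[W xW WB].
exists (projlim_map i @^-1` W); first by exists i, W.
by move=> y /WB /BA.
Qed.

HB.instance Definition _ := isLocallyMeasurable.Build d L
  projlim_nbase_measurable projlim_nbhs_nbase.

End projlim_structure.

(* Main.v *)
Require Import Defs.
From mathcomp Require Import all_boot all_order all_algebra.
From mathcomp Require Import all_classical all_reals all_analysis.

Set Implicit Arguments.
Unset Strict Implicit.
Unset Printing Implicit Defensive.
Import Order.TTheory GRing.Theory Num.Theory.
Local Open Scope classical_set_scope.
Local Open Scope ring_scope.

(** The rates of the image law [mu_ i] at [A] are the rates of [mu] at
    the cylinder [projlim_map i @^-1` A], and every point of the projective limit
    has a neighbourhood basis made of cylinders.  Parts (a) and (b) therefore
    only transport sets along the projections: refining the index enlarges the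
    family of available cylinders ([locinf_comp]), and in the limit every
    measurable neighbourhood contains a cylinder ([locinf_projlim]).

    For part (c), let [C] be the closure of [K `&` D], a compact set.  Since
    [mu n] does not see what lies outside [D], [mu n K] is at most the mass of
    the cylinder over [projlim_map i @` C] ([upper_rate_carried]).  That image is
    compact, hence measurable and closed, and the weak principle in [obj S i]
    bounds the upper rate of [K] by the supremum over [C] of
    [s_lower (mu_ i) v \o projlim_map i], for every [i].  It remains to exchange
    this supremum with the infimum over [i].  The functions
    [s_lower (mu_ i) v \o projlim_map i] are upper semicontinuous and decrease
    along the directed set [J], so this is Dini's argument on the compact set [C]
    ([directed_usc_lt]). *)

(** * Extended reals and Dini's argument *)

Lemma limf_esup_le (T : choiceType) (U : filteredType T) (R : realType)
    (f g : U -> \bar R) (F : set_system U) :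
  (forall x, f x <= g x)%E -> (limf_esup f F <= limf_esup g F)%E.
Proof.
move=> fg; rewrite !limf_esupE; apply: le_ereal_inf_tmp => _ [A FA <-].
apply: ge_ereal_inf; exists (ereal_sup (f @` A)); first by exists A.
apply: ge_ereal_sup => _ [x Ax <-]; apply: le_trans (fg x) _.
by apply: ereal_sup_ubound; exists x.
Qed.

Lemma ereal_between (R : realFieldType) (a b : \bar R) :
  (a < b)%E -> exists2 c, (a < c)%E & (c < b)%E.
Proof.
case: a b => [a| |] [b| |] //=.
- rewrite lte_fin => ab; exists ((a + b) / 2)%:E; rewrite lte_fin.
    by rewrite midf_lt.
  by rewrite midf_lt.
- by move=> _; exists (a + 1)%:E; rewrite ?ltry// lte_fin ltrDl.
- by move=> _; exists (b - 1)%:E; rewrite ?ltNyr// lte_fin ltrBlDr ltrDl.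
- by move=> _; exists 0%E; rewrite ?ltNy0 ?lt0y.
Qed.

(** Dini's argument: near each point of the compact set, [g j] is below [t] for
    all large [j].  The covering characterization of compactness, applied to the
    filter of sets of indices that contain all large ones, makes this uniform. *)
Lemma directed_usc_lt (R : realType) (disp : Order.disp_t)
    (J : preorderType disp) (T : topologicalType) (g : J -> T -> \bar R)
    (C : set T) (t : \bar R) :
  upward_directed J ->
  (forall i j x, (i <= j)%O -> (g j x <= g i x)%E) ->
  (forall i x, (g i x < t)%E -> \forall y \near x, (g i y < t)%E) ->
  compact C ->
  (forall x, C x -> (ereal_inf [set g i x | i in [set: J]] < t)%E) ->
  exists j, forall x, C x -> (g j x < t)%E.
Proof.
move=> [[i0 _] dirJ] g_dec g_usc /compact_near_coveringP cC Ct.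
pose F : set_system J := filter_from [set: J] (fun i => [set j | (i <= j)%O]).
have FF : ProperFilter F.
  apply: filter_from_proper => [|i _]; last by exists i => /=.
  apply: filter_from_filter; first by exists i0.
  move=> i j _ _; have [k [ik jk]] := dirJ i j; exists k => // l /= kl.
  by split; apply: le_trans kl.
suff /filter_ex[j CP] : \forall j \near F, C `<=` [set x | (g j x < t)%E].
  by exists j.
apply: cC => x Cx.
have [_ [i _ <-] gixt] := ereal_inf_lt (Ct x Cx).
exists ([set y | (g i y < t)%E], [set j | (i <= j)%O]) => /=.
  by split; [exact: g_usc|exists i].
by move=> [y j] /= [giy ij]; apply: le_lt_trans (g_dec _ _ _ ij) giy.
Qed.

(** * Infima over measurable neighbourhoods in a projective limit *)

(** The common shape of [s_lower] and [s_upper], for an arbitrary set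
    function [r] in place of the lower or upper rate. *)
Definition locinf (R : realType) (d : measure_display) (T : locMeasType d)
    (r : set T -> \bar R) (x : T) : \bar R :=
  ereal_inf [set r A | A in [set A | measurable A /\ interior A x]].

Section locinf.
Context {R : realType}.

Lemma locinf_le (d : measure_display) (T : locMeasType d) (r : set T -> \bar R)
    (x : T) (A : set T) :
  measurable A -> nbhs x A -> (locinf r x <= r A)%E.
Proof. by move=> mA xA; apply: ereal_inf_lbound; exists A. Qed.

Lemma locinf_usc (d : measure_display) (T : locMeasType d) (r : set T -> \bar R)
    (x : T) (t : \bar R) :
  (locinf r x < t)%E -> \forall y \near x, (locinf r y < t)%E.
Proof.
move=> /ereal_inf_lt[_ [A [mA xA] <-] At].
near=> y; apply: le_lt_trans At; apply: locinf_le => //; near: y.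
exact: nbhs_interior.
Unshelve. all: by end_near. Qed.

(** Measurable neighbourhoods pull back along [f]. *)
Lemma locinf_comp (d d' : measure_display) (T : locMeasType d)
    (U : locMeasType d') (f : {mfun T >-> U}) (r : set T -> \bar R) (x : T) :
  {for x, continuous f} ->
  (locinf r x <= locinf (fun A => r (f @^-1` A)) (f x))%E.
Proof.
move=> cf; apply: le_ereal_inf_tmp => _ [A [mA fxA] <-].
apply: locinf_le; last exact: cf.
by rewrite -[_ @^-1` _]setTI; exact: measurable_funPT.
Qed.

End locinf.

Section projective_limit.
Context {R : realType} {disp : Order.disp_t} {J : preorderType disp}
  {d : measure_display} {X : measurableType d} {dJ : J -> measure_display}
  (S : projSystem X dJ).

Lemma trans_continuous (i j : J) (ij : (i <= j)%O) : continuous (trans S ij).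
Proof.
move=> x A; rewrite nbhs_nbase => -[W xW WA].
rewrite nbhs_simpl/= nbhs_nbase; exists (trans S ij @^-1` W).
  exact: trans_nbase.
by move=> y /WA.
Qed.

Lemma locinf_antitone (r : set (projlim S) -> \bar R) (i j : J) (x : projlim S) :
  (i <= j)%O ->
  (locinf (fun A => r (@projlim_map _ _ _ _ _ S j @^-1` A)) (projlim_map j x) <=
   locinf (fun A => r (@projlim_map _ _ _ _ _ S i @^-1` A)) (projlim_map i x))%E.
Proof.
move=> ij.
have -> : @projlim_map _ _ _ _ _ S i = trans S ij \o projlim_map j.
  by apply/funext => y; exact: prj_trans.
exact: (locinf_comp (f := trans S ij)
  (fun A => r (@projlim_map _ _ _ _ _ S j @^-1` A)) (@trans_continuous _ _ ij _)).
Qed.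

(** The nontrivial inequality holds because a measurable neighbourhood of [x]
    contains a basic one, which is the preimage of a measurable neighbourhood of
    some [projlim_map i x]. *)
Lemma locinf_projlim (r : set (projlim S) -> \bar R) (x : projlim S) :
  (forall A B, measurable A -> measurable B -> A `<=` B -> r A <= r B)%E ->
  locinf r x = ereal_inf
    [set locinf (fun A => r (@projlim_map _ _ _ _ _ S i @^-1` A)) (projlim_map i x)
       | i in [set: J]].
Proof.
move=> r_mono; apply/eqP; rewrite eq_le; apply/andP; split.
  apply: le_ereal_inf_tmp => _ [i _ <-].
  exact/(locinf_comp (f := @projlim_map _ _ _ _ _ S i))/projlim_map_continuous.
apply: le_ereal_inf_tmp => _ [A [mA xA] <-].
move: xA; rewrite /interior nbhs_nbase => -[V xV VA].
have mV : measurable V by exact: nbase_measurable xV.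
have [i [W [xW VE]]] := xV; rewrite {}VE in VA mV.
apply: ge_ereal_inf.
exists (locinf (fun B => r (@projlim_map _ _ _ _ _ S i @^-1` B)) (projlim_map i x)).
  by exists i.
apply: le_trans (r_mono _ _ mV mA VA).
apply: (locinf_le (fun B => r (projlim_map i @^-1` B))).
  exact: nbase_measurable xW.
by rewrite nbhs_nbase; exists W.
Qed.

End projective_limit.

(** * Exponential rates *)

Section rates.
Context {R : realType} {d : measure_display} {T : locMeasType d}
  (nu : nat -> probability T R) (v : nat -> R) (v_gt0 : forall n, 0 < v n).

Lemma log_rate_le (A B : set T) (n : nat) :
  measurable A -> measurable B -> A `<=` B ->
  (log_rate nu v A n <= log_rate nu v B n)%E.
Proof.
move=> mA mB AB; apply: lee_wpmul2l; first by rewrite lee_fin invr_ge0 ltW.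
rewrite lee_lne ?in_itv/= ?leey ?measure_ge0//.
by apply: le_measure; rewrite ?inE.
Qed.

Lemma upper_rate_le (A B : set T) :
  measurable A -> measurable B -> A `<=` B ->
  (upper_rate nu v A <= upper_rate nu v B)%E.
Proof.
by move=> mA mB AB; apply: limf_esup_le => n; exact: log_rate_le.
Qed.

Lemma lower_rate_le (A B : set T) :
  measurable A -> measurable B -> A `<=` B ->
  (lower_rate nu v A <= lower_rate nu v B)%E.
Proof.
move=> mA mB AB; rewrite /lower_rate /limn_einf /limf_einf leeN2.
by apply: limf_esup_le => n /=; rewrite leeN2; exact: log_rate_le.
Qed.

(** [K] and [K `&` L] have the same trace on [D], hence the same mass. *)
Lemma upper_rate_carried (D K L : set T) :
  (forall n, carried_by (nu n) D) -> measurable K -> measurable L ->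
  K `&` D `<=` L -> (upper_rate nu v K <= upper_rate nu v L)%E.
Proof.
move=> nuD mK mL KDL.
have mKL : measurable (K `&` L) by exact: measurableI.
have -> : upper_rate nu v K = upper_rate nu v (K `&` L).
  congr limn_esup; apply/funext => n; rewrite /log_rate.
  rewrite (nuD n _ (K `&` L))//; apply/seteqP; split => [x [Kx Dx]|x [[]]//].
  by do !split => //; exact: KDL.
by apply: upper_rate_le => // x [].
Qed.

End rates.

(** * Large deviations in the projective limit *)

Theorem mainTheorem2 (R : realType)
    (disp : Order.disp_t) (J : preorderType disp)
    (d : measure_display) (X : measurableType d) (dJ : J -> measure_display)
    (S : projSystem X dJ)
    (haus_obj : forall i : J, hausdorff_space (obj S i))
    (haus_lim : hausdorff_space (projlim S))
    (mu : nat -> probability (projlim S) R)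
    (v : nat -> R) (v_gt0 : forall n : nat, 0 < v n) :
  let mu_ (i : J) : nat -> probability (obj S i) R :=
    fun n => distribution (mu n) (@projlim_map _ _ _ _ _ S i) in

  ((forall i : J, SAC_flat (mu_ i) v) -> SAC_flat mu v) /\

  [/\ forall i j : J, (i <= j)%O -> forall x : projlim S,
        (s_lower (mu_ j) v (projlim_map j x)
           <= s_lower (mu_ i) v (projlim_map i x))%E /\
        (s_upper (mu_ j) v (projlim_map j x)
           <= s_upper (mu_ i) v (projlim_map i x))%E,
      forall x : projlim S, s_lower mu v x =
        ereal_inf [set s_lower (mu_ i) v (projlim_map i x) | i in [set: J]],
      forall x : projlim S, s_upper mu v x =
        ereal_inf [set s_upper (mu_ i) v (projlim_map i x) | i in [set: J]]
    & (forall i : J, s_lower (mu_ i) v =1 s_upper (mu_ i) v) ->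
        s_lower mu v =1 s_upper mu v] /\

  (forall D : set (projlim S), (forall n : nat, carried_by (mu n) D) ->
     (forall i : J, (forall K : set (obj S i), compact K -> measurable K) /\
        weak_LDP (mu_ i) v) ->
     BS_flat D mu v).
Proof.
move=> mu_.
have mono_l := lower_rate_le mu v_gt0; have mono_u := upper_rate_le mu v_gt0.
have anti_l (i j : J) (ij : (i <= j)%O) (x : projlim S) :
    (s_lower (mu_ j) v (projlim_map j x) <= s_lower (mu_ i) v (projlim_map i x))%E.
  exact: (locinf_antitone (lower_rate mu v)).
have anti_u (i j : J) (ij : (i <= j)%O) (x : projlim S) :
    (s_upper (mu_ j) v (projlim_map j x) <= s_upper (mu_ i) v (projlim_map i x))%E.
  exact: (locinf_antitone (upper_rate mu v)).
have s_lowerE (x : projlim S) : s_lower mu v x =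
    ereal_inf [set s_lower (mu_ i) v (projlim_map i x) | i in [set: J]].
  exact: (@locinf_projlim _ _ _ _ _ _ S (lower_rate mu v)).
have s_upperE (x : projlim S) : s_upper mu v x =
    ereal_inf [set s_upper (mu_ i) v (projlim_map i x) | i in [set: J]].
  exact: (@locinf_projlim _ _ _ _ _ _ S (upper_rate mu v)).
split; last split.
- move=> sac x _ [i [W [xW ->]]]; have [A xA AW] := sac i _ _ xW.
  by exists (projlim_map i @^-1` A); first by exists i, A.
- split=> //; first by move=> i j ij x; split; [exact: anti_l|exact: anti_u].
  move=> eq_s x; rewrite s_lowerE s_upperE; congr ereal_inf.
  by apply: eq_imagel => i _; exact: eq_s.
- move=> D muD ldp K mK; rewrite precompactE => cC.
  set C := closure _ in cC.
  have CK : C `<=` closure K by apply: closure_subset => x [].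
  have leC (i : J) : (upper_rate mu v K <=
      ereal_sup [set s_lower (mu_ i) v (projlim_map i x) | x in C])%E.
    have [meas_cpt ldp_i] := ldp i.
    have cL : compact (@projlim_map _ _ _ _ _ S i @` C).
      apply: continuous_compact cC; apply: continuous_subspaceT.
      exact: projlim_map_continuous.
    have mL := meas_cpt _ cL.
    have clL : closure (@projlim_map _ _ _ _ _ S i @` C) = projlim_map i @` C.
      by apply/esym/closure_id; exact: compact_closed.
    have KL : (upper_rate mu v K <= upper_rate (mu_ i) v (projlim_map i @` C))%E.
      apply: (upper_rate_carried v_gt0 muD mK
        (L := projlim_map i @^-1` (projlim_map i @` C))).
        by rewrite -[_ @^-1` _]setTI; exact: measurable_funPT.
      by move=> x KDx; exists x => //; exact: subset_closure.
    apply: le_trans KL (le_trans (ldp_i _ mL _) _); first by rewrite precompactE clL.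
    rewrite clL; apply: ge_ereal_sup => _ [_ [x Cx <-] <-].
    by apply: ereal_sup_ubound; exists x.
  (* Strict bounds by [t] at each point of [C] bound the supremum by [t] only
     weakly, so [t] has to lie strictly below the upper rate of [K]. *)
  rewrite leNgt; apply/negP => /ereal_between[t sup_lt lt_upper].
  have [||||j gj] := @directed_usc_lt R _ J (projlim S)
    (fun i x => s_lower (mu_ i) v (projlim_map i x)) C t (index_directed S).
  + by move=> i j x ij; exact: anti_l.
  + by move=> i x /locinf_usc; exact: projlim_map_continuous.
  + exact: cC.
  + move=> x Cx; rewrite -s_lowerE; apply: le_lt_trans sup_lt.
    by apply: ereal_sup_ubound; exists x => //; exact: CK.
  have := lt_le_trans lt_upper (leC j); rewrite ltNge => /negP; apply.
  by apply: ge_ereal_sup => _ [x Cx <-]; apply/ltW/gj.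
Qed.
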